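(* Let $i\geq1$ and let $T$ be an SSRT of straight partition shape $\lambda$ such that $\lambda$ has an addable node in column $i+1$. Then $\phi_{i+1}(\rho^{-1}(T))=\rho^{-1}(\mathrm{tjdt}_{i+1}(T))$; in particular $\phi_{i+1}(\rho^{-1}(T))$ is an SSRCT.
   Context: SSRTs (French convention, rows numbered from bottom, box $(r,c)$ = row $r$, column $c$): fillings of a partition shape by positive integers weakly decreasing along rows left to right and strictly decreasing up columns. For an SSRT $T$ of shape $\lambda$ with an addable node in column $i+1$, set $T_{(p,q)}=0$ if $(p,q)\notin\lambda$ and $T_{(0,q)}=\infty$; let $r$ be the largest integer such that $(r,i)\in\lambda$ and $T_{(r,i)}<T_{(r-1,i+1)}$ (this is the first entry that moves horizontally during a backward jeu de taquin slide from the addable node in column $i+1$). Then $\mathrm{tjdt}_{i+1}(T)$ is obtained from $T$ by removing the entry $T_{(r,i)}$ and sliding every entry of column $i$ above it down by one row, leaving all other entries unchanged. SSRCTs: compositions drawn as reverse composition diagrams (row $r$ from the top has $\alpha_r$ left-justified boxes). An SSRCT of shape $\alpha$ is a filling by positive integers with (1) rows weakly decreasing left to right, (2) first column strictly increasing top to bottom, (3) for rows $r<s$ and column $c$ with $(s,c+1)\in\alpha$: if $(r,c)\in\alpha$ and $\tau(r,c)\geq\tau(s,c+1)$ then $(r,c+1)\in\alpha$ and $\tau(r,c+1)>\tau(s,c+1)$. The map $\rho$ sends an SSRCT to the SSRT obtained by writing the entries of each column in decreasing order from bottom to top, bottom-justified; it is a known bijection between SSRCTs and SSRTs of straight shape.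 $\phi_{i+1}$: for an SSRCT $\tau$ of shape $\alpha$ with a part equal to $i$ (set $\tau(r,c)=0$ outside $\alpha$), let $r_1$ be the largest index with $\alpha_{r_1}=i$, and for $j\geq2$ let $r_j$ be the largest $r<r_{j-1}$ with $\tau(r,i)>\tau(r_{j-1},i)\geq\tau(r,i+1)$, ending with $r_k$. Then $\phi_{i+1}(\tau)$ is obtained by placing, for $j=k,\ldots,2$, the original entry $\tau(r_{j-1},i)$ into box $(r_j,i)$, and deleting box $(r_1,i)$ (and the row, if empty); the entry $\tau(r_k,i)$ exits. *)

(* Defs.v *)
From mathcomp Require Import all_boot.

Set Implicit Arguments.
Unset Strict Implicit.
Unset Printing Implicit Defensive.

(* A filling is a list of rows; each row is listed left to right.
   Rows and columns are numbered from 1.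
   - For an SSRT (French convention) row 1 of the list is the BOTTOM row.
   - For an SSRCT (reverse composition diagram) row 1 is the TOP row. *)
Definition tab := seq (seq nat).

Definition row_of (t : tab) (r : nat) : seq nat := nth [::] t r.-1.

Definition inb (t : tab) (r c : nat) : bool :=
  [&& 0 < r, 0 < c, r <= size t & c <= size (row_of t r)].

Definition ent (t : tab) (r c : nat) : nat :=
  if inb t r c then nth 0 (row_of t r) c.-1 else 0.

Definition colLen (t : tab) (c : nat) : nat :=
  count (fun row => c <= size row) t.

Definition mk_tab (sh : seq nat) (f : nat -> nat -> nat) : tab :=
  [seq row <- [seq [seq f r c | c <- iota 1 (nth 0 sh r.-1)] | r <- iota 1 (size sh)]
   | row != [::]].

Definition is_SSRT (T : tab) : Prop :=
  [/\ all (fun row => 0 < size row) T,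
      sorted geq (map size T),
      all (all (fun x => 0 < x)) T,
      (forall r c, 0 < c -> inb T r c.+1 -> ent T r c.+1 <= ent T r c)
    & (forall r c, 0 < r -> inb T r.+1 c -> ent T r.+1 c < ent T r c)
        (* columns strictly decreasing going up *) ].

Definition is_SSRCT (t : tab) : Prop :=
  [/\ all (fun row => 0 < size row) t,
      all (all (fun x => 0 < x)) t,
      (forall r c, 0 < c -> inb t r c.+1 -> ent t r c.+1 <= ent t r c),
      (forall r s, 0 < r -> r < s -> s <= size t -> ent t r 1 < ent t s 1)
    & (forall r s c, 0 < r -> r < s -> 0 < c -> inb t s c.+1 -> inb t r c ->
         ent t s c.+1 <= ent t r c ->
         inb t r c.+1 /\ ent t s c.+1 < ent t r c.+1)
        (* (3) triple condition *) ].

Definition colvals (t : tab) (c : nat) : seq nat :=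
  [seq ent t r c | r <- [seq r <- iota 1 (size t) | inb t r c]].

(* column c sorted decreasingly: this is column c of rho t, from bottom to top *)
Definition sortcol (t : tab) (c : nat) : seq nat := sort geq (colvals t c).

Definition ncols (t : tab) : nat := foldr maxn 0 (map size t).

Definition rho (t : tab) : tab :=
  mk_tab [seq count (fun c => r <= size (sortcol t c)) (iota 1 (ncols t))
         | r <- iota 1 (size t)]
         (fun r c => nth 0 (sortcol t c) r.-1).

(* the row r of the first entry of column i = k-1 moving horizontally *)
Definition tjdt_row (k : nat) (T : tab) : nat :=
  let i := k.-1 in
  \max_(1 <= r < (size T).+1 |
          inb T r i && ((r == 1) || (ent T r i < ent T r.-1 k))) r.

Definition tjdt (k : nat) (T : tab) : tab :=
  let i := k.-1 in
  let rr := tjdt_row k T in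
  let h := colLen T i in
  mk_tab [seq (if r == h then (size (row_of T r)).-1 else size (row_of T r))
         | r <- iota 1 (size T)]
         (fun r c => if (c == i) && (rr <= r) then ent T r.+1 i else ent T r c).

Definition phi_r1 (k : nat) (t : tab) : nat :=
  \max_(1 <= r < (size t).+1 | size (row_of t r) == k.-1) r.

(* largest r < r' with t(r,i) > t(r',i) >= t(r,i+1); 0 if there is none *)
Definition phi_next (k : nat) (t : tab) (r' : nat) : nat :=
  let i := k.-1 in
  \max_(1 <= r < r' | (ent t r' i < ent t r i) && (ent t r k <= ent t r' i)) r.

Fixpoint phi_chain_aux (k : nat) (t : tab) (fuel r : nat) : seq nat :=
  match fuel with
  | 0 => [:: r]
  | fuel'.+1 =>
      let r2 := phi_next k t r in
      if r2 == 0 then [:: r] else r :: phi_chain_aux k t fuel' r2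
  end.

Definition phi_chain (k : nat) (t : tab) : seq nat :=
  phi_chain_aux k t (phi_r1 k t) (phi_r1 k t).

Definition phi (k : nat) (t : tab) : tab :=
  let i := k.-1 in
  let r1 := phi_r1 k t in
  let rs := phi_chain k t in
  mk_tab [seq (if r == r1 then (size (row_of t r)).-1 else size (row_of t r))
         | r <- iota 1 (size t)]
         (fun r c => if (c == i) && (r \in behead rs)
                     then ent t (nth 0 rs (index r rs).-1) i
                     else ent t r c).

(* Main.v *)
Require Import Defs.
From mathcomp Require Import all_boot.
From mathcomp Require Import zify.

(** Let [r_1 > ... > r_k] be the rows visited by [phi] and [y_j] the entry of
    [tau] in box [(r_j, i)].  For [y] in column [i], let [d y] be the number of
    rows [r] with [tau(r,i) > y >= tau(r,i+1)]; since rows decrease, [d y] is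
    also the number of entries [> y] in column [i] minus the number of those in
    column [i+1], hence depends only on [rho tau].  In terms of [rho tau], the
    row chosen by [tjdt] holds the smallest [y] of column [i] with [d y = 0].
    The chain gives [d y > 0] for every [y < y_k], because [r_j] is a witness
    when [y_{j-1} <= y < y_j].  Conversely the triple condition shows, by
    induction on [j], that every row counted by [d y_j] lies above row [r_j],
    so the chain stops exactly when [d y_k = 0].  Thus [y_k] is the entry removed
    by [tjdt], and a tableau is determined by its column sets.  The same
    induction, with the maximality of each [r_j], gives the triple condition
    after the shift. *)

(** * Boxes, bounded maxima and sorted lists *)

(** A row past the end reads as [[::]], so a positive column inside the row already bounds [r]. *)
Lemma inbE t r c :
  inb t r c = [&& 0 < r, 0 < c & c <= size (row_of t r)].
Proof.
rewrite /inb; case: r => // r; case: c => //= c.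
by case: (ltnP r (size t)) => //= h; rewrite /row_of nth_default.
Qed.

Lemma ent_gt0_inb t r c : 0 < ent t r c -> inb t r c.
Proof. by rewrite /ent; case: (inb t r c). Qed.

Lemma inb_lt t r c c' : 0 < c' -> c' <= c -> inb t r c -> inb t r c'.
Proof.
rewrite !inbE => c0 h /and3P[-> _ h2]; rewrite c0 /=; exact: leq_trans h2.
Qed.

Lemma geq_trans : transitive geq.
Proof. by move=> a b c /= h1 h2; apply: leq_trans h2 h1. Qed.

Lemma eq_leq_pos a b : (forall c, 0 < c -> (c <= a) = (c <= b)) -> a = b.
Proof.
move=> h; apply/eqP; rewrite eqn_leq; apply/andP; split.
  by case: (posnP a) => [-> //|a0]; rewrite -h.
by case: (posnP b) => [-> //|b0]; rewrite h.
Qed.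

(** Candidates start at 1, so the value 0 signals that there is none. This covers [phi_r1],
    [phi_next] and [tjdt_row]. *)
Lemma max_natP (P : pred nat) n (m := \max_(1 <= r < n | P r) r) :
  (m = 0 \/ [/\ 0 < m, m < n & P m]) /\
  (forall r, 0 < r -> r < n -> P r -> r <= m).
Proof.
split; last first.
  move=> r r0 rn Pr; have h : r \in index_iota 1 n by rewrite mem_index_iota r0.
  exact: (leq_bigmax_seq (F := id) r h Pr).
rewrite /m big_nat_cond; elim/big_ind: _; first by left.
  by move=> x y hx hy; case: (leqP x y).
by move=> r /andP[/andP[r0 rn] Pr]; right.
Qed.

(** The positive integers satisfying [P] form an initial segment, and the count is its length, cut
    off at [n]. *)
Lemma count_antitone (P : pred nat) n c :
  (forall a b, 0 < a -> a <= b -> P b -> P a) -> 0 < c ->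
  (c <= count P (iota 1 n)) = (c <= n) && P c.
Proof.
move=> hP c0; elim: n => [|n IH]; first by case: c c0.
rewrite -{1}(addn1 n) iotaD count_cat /= addn0 add1n.
have cn : count P (iota 1 n) <= n by rewrite -{2}(size_iota 1 n) count_size.
have h : P n.+1 -> count P (iota 1 n) = n.
  move=> Pn; rewrite -[RHS](size_iota 1 n); apply/eqP; rewrite -all_count.
  by apply/allP => x; rewrite mem_iota => hx; apply: (hP _ n.+1); lia.
case Pn: (P n.+1) => /=.
  rewrite h // addn1; case: leqP => //= hc.
  by symmetry; apply: (hP _ n.+1).
rewrite addn0 IH; case: (ltngtP c n.+1) => hc //=.
- by rewrite -ltnS hc.
- by rewrite leqNgt (ltn_trans _ hc).
by rewrite hc Pn ltnn.
Qed.

Lemma nth_map_iota1 (F : nat -> nat) n r :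
  0 < r -> (n < r -> F r = 0) -> nth 0 [seq F r | r <- iota 1 n] r.-1 = F r.
Proof.
case: r => // r _ h /=; case: (ltnP r n) => hr.
  by rewrite (nth_map 0) ?size_iota // nth_iota // add1n.
by rewrite nth_default ?size_map ?size_iota // h.
Qed.

(** The entries above [x] form a prefix of a decreasing list; past the end, the default 0 exceeds
    nothing. This turns comparisons of entries into counts. *)
Lemma gt_nth_sorted s x j :
  sorted geq s -> (x < nth 0 s j) = (j < count (fun y => x < y) s).
Proof.
elim: s j => [|a s IH] j; first by rewrite nth_nil.
rewrite /= path_sortedE; last exact: geq_trans.
move=> /andP[ha ss]; case: j => [|j] /=.
  case: (ltnP x a) => //= xa; symmetry; apply/negbTE; rewrite -leqNgt leqn0.
  rewrite -[_ == 0]negbK -lt0n -has_count; apply/hasPn => y ys.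
  by rewrite -leqNgt; apply: leq_trans xa; move/allP: ha; apply.
rewrite IH //; case: (ltnP x a) => xa; first by rewrite add1n ltnS.
suff -> : count (fun y => x < y) s = 0 by [].
apply/eqP; rewrite -[_ == 0]negbK -lt0n -has_count; apply/hasPn => y ys.
by rewrite -leqNgt; apply: leq_trans xa; move/allP: ha; apply.
Qed.

(** * Dropping the empty rows of a filling *)

(** This is [mk_tab] before the filter: rows still carry the numbers used by [sh] and [f]. *)
Definition unfiltered (sh : seq nat) (f : nat -> nat -> nat) : tab :=
  [seq [seq f r c | c <- iota 1 (nth 0 sh r.-1)] | r <- iota 1 (size sh)].

Lemma row_unfiltered sh f r : 0 < r ->
  row_of (unfiltered sh f) r = [seq f r c | c <- iota 1 (nth 0 sh r.-1)].
Proof.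
case: r => // r _; rewrite /row_of /=.
case: (ltnP r (size sh)) => h; last by rewrite !nth_default ?size_map ?size_iota.
by rewrite (nth_map 0) ?size_iota // nth_iota // add1n.
Qed.

Lemma inb_unfiltered sh f r c :
  inb (unfiltered sh f) r c = [&& 0 < r, 0 < c & c <= nth 0 sh r.-1].
Proof.
by rewrite inbE; case: r => // r; rewrite row_unfiltered // size_map size_iota.
Qed.

Lemma ent_unfiltered sh f r c : 0 < r -> 0 < c ->
  ent (unfiltered sh f) r c = if c <= nth 0 sh r.-1 then f r c else 0.
Proof.
move=> r0 c0; rewrite /ent inb_unfiltered r0 c0 /= row_unfiltered //.
case: c c0 => // c _; case: leqP => // h.
by rewrite (nth_map 0) ?size_iota //= nth_iota // add1n.
Qed.

(** [g] sends a row number after the filter to its number before. Its image contains every row that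
    has a box. *)
Lemma nonempty_rows_index (t : tab) (t' := [seq row <- t | row != [::]]) :
  exists g : nat -> nat,
  [/\ forall r, 0 < r -> r <= size t' -> 0 < g r /\ row_of t' r = row_of t (g r),
      forall r s, 0 < r -> r < s -> s <= size t' -> g r < g s
    & forall r c, inb t r c -> exists r', [/\ 0 < r', r' <= size t' & g r' = r]].
Proof.
pose J := [seq j <- iota 0 (size t) | nth [::] t j != [::]].
have et : t' = [seq nth [::] t j | j <- J].
  rewrite /t' -{1}(mkseq_nth [::] t) /mkseq filter_map; congr map.
have st : size t' = size J by rewrite et size_map.
exists (fun r => (nth 0 J r.-1).+1); split.
- move=> [|r] // _ hr; split=> //.
  by rewrite /row_of /= et (nth_map 0) // -st.
- move=> [|r] [|s] // _ rs ss /=; rewrite ltnS.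
  apply: (sorted_ltn_nth ltn_trans); rewrite ?inE -?st //.
    by apply: sorted_filter; [exact: ltn_trans | exact: iota_ltn_sorted].
  by apply: ltn_trans ss.
move=> r c; rewrite /inb => /and4P[r0 c0 rt hc].
have rJ : r.-1 \in J.
  rewrite mem_filter mem_iota /= add0n prednK // rt andbT.
  by apply: contraTneq hc; rewrite /row_of => ->; rewrite -ltnNge.
exists (index r.-1 J).+1; split => //; first by rewrite st index_mem.
by rewrite /= nth_index // prednK.
Qed.

Lemma inb_ent_row t t' r r' c : 0 < r -> 0 < r' -> row_of t r = row_of t' r' ->
  inb t r c = inb t' r' c /\ ent t r c = ent t' r' c.
Proof. by move=> r0 r0' e; rewrite /ent !inbE r0 r0' e. Qed.

(** The SSRCT conditions compare rows only through their relative order, which the increasing map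
    [g] preserves, so they can be checked before empty rows are dropped. *)
Lemma SSRCT_mk_tab sh f (a := fun r => nth 0 sh r.-1) :
  (forall r c, 0 < r -> 0 < c -> c <= a r -> 0 < f r c) ->
  (forall r c, 0 < r -> 0 < c -> c < a r -> f r c.+1 <= f r c) ->
  (forall r s, 0 < r -> r < s -> 0 < a r -> 0 < a s -> f r 1 < f s 1) ->
  (forall r s c, 0 < r -> r < s -> 0 < c -> c < a s -> c <= a r ->
     f s c.+1 <= f r c -> c < a r /\ f s c.+1 < f r c.+1) ->
  is_SSRCT (mk_tab sh f).
Proof.
move=> fpos frow fcol ftrip.
have [g [g1 g2 _]] := nonempty_rows_index (unfiltered sh f).
rewrite -/(mk_tab sh f) in g1 g2.
have hn : all (fun row => 0 < size row) (mk_tab sh f).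
  by apply/allP => row; rewrite mem_filter => /andP[]; case: row.
have inbg r c : 0 < r -> r <= size (mk_tab sh f) -> 0 < c ->
    [/\ 0 < g r, inb (mk_tab sh f) r c = (c <= a (g r))
     & ent (mk_tab sh f) r c = if c <= a (g r) then f (g r) c else 0].
  move=> r0 hr c0; have [gr e] := g1 r r0 hr.
  have [-> ->] := inb_ent_row _ _ _ _ c r0 gr e.
  by rewrite inb_unfiltered ent_unfiltered // gr c0.
have inbs t r c : inb t r c -> [/\ 0 < r, r <= size t & 0 < c].
  by case/and4P.
split=> //.
- apply/allP => row; rewrite mem_filter => /andP[_ /mapP[r]].
  rewrite mem_iota => /andP[r0 _] ->; apply/allP => x /mapP[c].
  rewrite mem_iota add1n ltnS => /andP[c0 hc] ->; exact: fpos.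
- move=> r c c0 h; have [r0 hr _] := inbs _ _ _ h.
  have [_ _ ->] := inbg r c r0 hr c0.
  move: h; have [gr -> ->] := inbg r c.+1 r0 hr isT => h.
  by rewrite h (ltnW h); apply: frow.
- move=> r s r0 rs hs.
  have h1 r' : 0 < r' -> r' <= size (mk_tab sh f) -> inb (mk_tab sh f) r' 1.
    case: r' => // r' _ h; rewrite /inb /= h /row_of /=.
    by move/allP: hn; apply; apply: mem_nth.
  have hr : r <= size (mk_tab sh f) by apply: ltnW; apply: leq_trans hs.
  have s0 : 0 < s by apply: leq_ltn_trans rs.
  move: (h1 r r0 hr) (h1 s s0 hs).
  have [gr -> ->] := inbg r 1 r0 hr isT; have [gs -> ->] := inbg s 1 s0 hs isT.
  by move=> ar as_; rewrite ar as_; apply: fcol => //; apply: g2.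
move=> r s c r0 rs c0 hs hr; have [s0 ss _] := inbs _ _ _ hs.
have [_ rr _] := inbs _ _ _ hr; move: hs hr.
have [gr -> ->] := inbg r c r0 rr c0; have [_ -> ->] := inbg r c.+1 r0 rr isT.
have [gs -> ->] := inbg s c.+1 s0 ss isT => hs hr; rewrite hs hr => hle.
by have [h1 h2] := ftrip _ _ _ gr (g2 _ _ r0 rs ss) c0 hs hr hle; rewrite h1.
Qed.

Lemma colvalsP t c v :
  reflect (exists r, inb t r c /\ v = ent t r c) (v \in colvals t c).
Proof.
apply: (iffP mapP) => [[r]|[r [hr ->]]].
  by rewrite mem_filter => /andP[hr _] ->; exists r.
exists r => //; rewrite mem_filter hr mem_iota /=.
by case/and4P: hr => -> _ hr _; rewrite add1n ltnS.
Qed.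

Lemma mem_colvals_mk_tab sh f c v : 0 < c ->
  v \in colvals (mk_tab sh f) c <->
  exists r, [/\ 0 < r, c <= nth 0 sh r.-1 & v = f r c].
Proof.
move=> c0; have [g [g1 _ g3]] := nonempty_rows_index (unfiltered sh f).
rewrite -/(mk_tab sh f) in g1 g3; split.
  case/colvalsP => r [hr ->]; case/and4P: (hr) => r0 _ rs _.
  have [gr e] := g1 r r0 rs; exists (g r); move: hr.
  have [-> ->] := inb_ent_row _ _ _ _ c r0 gr e.
  by rewrite ent_unfiltered // inb_unfiltered => /and3P[-> _ h]; rewrite h.
case=> r [r0 hc ->]; apply/colvalsP.
have hi : inb (unfiltered sh f) r c by rewrite inb_unfiltered r0 c0.
have [r' [r0' rs' e]] := g3 r c hi.
have [gr er] := g1 r' r0' rs'; exists r'.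
have [-> ->] := inb_ent_row _ _ _ _ c r0' gr er.
by rewrite e hi ent_unfiltered // hc.
Qed.

Lemma mk_tab_eq sh1 f1 sh2 f2 :
  (forall r c, 0 < r -> 0 < c -> (c <= nth 0 sh1 r.-1) = (c <= nth 0 sh2 r.-1)) ->
  (forall r c, 0 < r -> 0 < c -> c <= nth 0 sh1 r.-1 -> f1 r c = f2 r c) ->
  mk_tab sh1 f1 = mk_tab sh2 f2.
Proof.
move=> hs hf; pose N := maxn (size sh1) (size sh2).
(* Beyond [size sh] the default length is 0, so padding up to [N] adds only rows that the filter
   drops. *)
have pad sh f : size sh <= N -> mk_tab sh f =
    [seq row <- [seq [seq f r c | c <- iota 1 (nth 0 sh r.-1)] | r <- iota 1 N] | row != [::]].
  move=> h; rewrite -(subnKC h) iotaD map_cat filter_cat -[LHS]cats0; congr cat.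
  symmetry; apply/eqP; rewrite -[_ == _]negbK -has_filter; apply/hasPn => row /mapP[r].
  rewrite mem_iota => /andP[hr _] ->; rewrite nth_default //.
  by rewrite -ltnS prednK //; apply: leq_ltn_trans hr.
rewrite !pad ?leq_maxl ?leq_maxr //; congr filter.
apply/eq_in_map => r; rewrite mem_iota => /andP[r0 _].
rewrite -(eq_leq_pos _ _ (fun c => hs r c r0)).
apply/eq_in_map => c; rewrite mem_iota add1n ltnS => /andP[c0 hc].
exact: hf.
Qed.

(** * Entries in the columns of an SSRCT *)

Lemma SSRCT_pos t r c : is_SSRCT t -> inb t r c -> 0 < ent t r c.
Proof.
case=> _ /allP h _ _ _ hi; rewrite /ent hi; case/and4P: hi => r0 c0 rt ct.
have /allP : all (fun x => 0 < x) (row_of t r).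
  by apply: h; apply: mem_nth; rewrite prednK.
by apply; apply: mem_nth; rewrite prednK.
Qed.

Lemma SSRCT_row_le t r c : is_SSRCT t -> 0 < c -> ent t r c.+1 <= ent t r c.
Proof.
case=> _ _ h _ _ c0; case hi : (inb t r c.+1); first exact: h.
by rewrite /ent hi.
Qed.

(** Column 1 is strictly increasing. In a later column, equal entries would meet the hypothesis of
    the triple condition because rows decrease, and its conclusion is a strict inequality between
    them. *)
Lemma SSRCT_col_inj t r s c : is_SSRCT t ->
  inb t r c -> inb t s c -> ent t r c = ent t s c -> r = s.
Proof.
move=> ht; wlog rs : r s / r < s.
  move=> h hr hs e; case: (ltngtP r s) => // hrs; first exact: h.
  by symmetry; apply: h.
case: (ht) => _ _ _ h4 h5 hr hs.
case/and4P: (hr) => r0 c0 rt _; case/and4P: (hs) => _ _ st _.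
case: c c0 hr hs => // [[|c]] _ hr hs e.
  by move: (h4 r s r0 rs st); rewrite e ltnn.
have hr' : inb t r c.+1 by apply: inb_lt hr.
have := h5 r s c.+1 r0 rs isT hs hr'; rewrite -e => h.
by have [_] := h (SSRCT_row_le _ r c.+1 ht isT); rewrite ltnn.
Qed.

Lemma SSRCT_colvals_uniq t c : is_SSRCT t -> uniq (colvals t c).
Proof.
move=> ht; rewrite map_inj_in_uniq ?filter_uniq ?iota_uniq // => r s.
rewrite !mem_filter => /andP[hr _] /andP[hs _]; exact: SSRCT_col_inj.
Qed.

(** * Shape and entries of [rho] *)

Lemma size_sortcol t c : size (sortcol t c) = count (fun r => inb t r c) (iota 1 (size t)).
Proof. by rewrite size_sort size_map size_filter. Qed.

Lemma colLenE t c : 0 < c -> colLen t c = size (sortcol t c).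
Proof.
move=> c0; rewrite size_sortcol /colLen -{1}(mkseq_nth [::] t) /mkseq.
rewrite (iotaDl 1 0) !count_map; apply: eq_in_count => r.
by rewrite mem_iota /inb /= add0n => hr; rewrite c0 add1n hr.
Qed.

Lemma colLen_anti t c c' : c <= c' -> colLen t c' <= colLen t c.
Proof. by move=> h; apply: sub_count => row; apply: leq_trans. Qed.

Lemma colLen_ncols t c : 0 < colLen t c -> c <= ncols t.
Proof.
rewrite /ncols /colLen -has_count; elim: t => //= row t IH /orP[h|h].
  by apply: leq_trans h _; rewrite leq_maxl.
by apply: leq_trans (IH h) _; rewrite leq_maxr.
Qed.

Lemma sortcol_sorted t c : sorted geq (sortcol t c).
Proof. by apply: sort_sorted => a b; rewrite /geq /= leq_total. Qed.

(** Column heights weakly decrease in [c], so the row counts in [rho] describe the diagram whose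
    column heights are [colLen t c]. *)
Lemma rho_shapeP t r c : 0 < r -> 0 < c ->
  (c <= nth 0 [seq count (fun c => r <= size (sortcol t c)) (iota 1 (ncols t))
              | r <- iota 1 (size t)] r.-1) = (r <= colLen t c).
Proof.
move=> r0 c0.
have hsz c' : 0 < c' -> size (sortcol t c') <= size t.
  by move=> c0'; rewrite -colLenE // count_size.
rewrite (@nth_map_iota1 (fun r => count (fun c => r <= size (sortcol t c)) (iota 1 (ncols t)))) //.
- rewrite count_antitone // -?colLenE //; last first.
    move=> a b a0 ab h; apply: leq_trans h _; rewrite -!colLenE //; last by lia.
    exact: colLen_anti.
  apply: andb_idl => h; apply: colLen_ncols; exact: leq_trans h.
move=> h; apply/eqP; rewrite -[_ == 0]negbK -lt0n -has_count; apply/hasPn => x.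
rewrite mem_iota => /andP[x0 _]; rewrite -ltnNge.
by apply: leq_ltn_trans h; apply: hsz.
Qed.

(** Every row of [t] has a box in column 1, so no row of [rho t] is empty and the filter does
    nothing. *)
Lemma rho_unfiltered t : all (fun row => 0 < size row) t ->
  rho t = unfiltered [seq count (fun c => r <= size (sortcol t c)) (iota 1 (ncols t))
         | r <- iota 1 (size t)]
         (fun r c => nth 0 (sortcol t c) r.-1).
Proof.
move=> ht; apply/all_filterP/allP => row /mapP[r].
rewrite size_map size_iota mem_iota add1n ltnS => /andP[r0 hr] ->.
rewrite -size_eq0 size_map size_iota -lt0n rho_shapeP //.
by rewrite /colLen (eq_in_count (a2 := xpredT)) ?count_predT //; apply/allP.
Qed.

Lemma inb_rho t r c : all (fun row => 0 < size row) t -> 0 < r -> 0 < c ->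
  inb (rho t) r c = (r <= colLen t c).
Proof.
by move=> ht r0 c0; rewrite rho_unfiltered // inb_unfiltered r0 c0 rho_shapeP.
Qed.

Lemma ent_rho t r c : all (fun row => 0 < size row) t -> 0 < r -> 0 < c ->
  ent (rho t) r c = nth 0 (sortcol t c) r.-1.
Proof.
move=> ht r0 c0; rewrite rho_unfiltered // ent_unfiltered // rho_shapeP //.
rewrite colLenE //; case: leqP => // h; rewrite nth_default //.
by rewrite -ltnS prednK.
Qed.

Lemma size_rho t : all (fun row => 0 < size row) t -> size (rho t) = size t.
Proof. by move=> ht; rewrite rho_unfiltered // /unfiltered !(size_map, size_iota). Qed.

Lemma colLen_rho t c : all (fun row => 0 < size row) t -> 0 < c ->
  colLen (rho t) c = colLen t c.
Proof.
move=> ht c0; rewrite [LHS]colLenE // size_sortcol size_rho //.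
rewrite (eq_in_count (a2 := fun r => r <= colLen t c)); last first.
  by move=> r; rewrite mem_iota => /andP[r0 _]; apply: inb_rho.
apply: eq_leq_pos => r r0; rewrite count_antitone //; last by move=> a b; lia.
by apply: andb_idl => h; apply: leq_trans h _; apply: count_size.
Qed.

(** Outside the diagram [ent] is 0 and never counted, so the count may run over all rows; adjacent
    columns can then be compared row by row. *)
Lemma count_sortcol t c y :
  count (fun x => y < x) (sortcol t c) = count (fun r => y < ent t r c) (iota 1 (size t)).
Proof.
rewrite /sortcol (permP (permEl (perm_sort _ _))) /colvals count_map count_filter.
apply: eq_count => r /=; apply: andb_idr.
by move=> h; apply: ent_gt0_inb; apply: leq_ltn_trans h.
Qed.

(** Column entries are distinct, so the set of values determines the sorted column. *)
Lemma eq_sortcol t c s : is_SSRCT t -> uniq s -> sorted geq s ->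
  colvals t c =i s -> sortcol t c = s.
Proof.
move=> ht us ss e; apply: (@sorted_eq _ geq) => //.
- exact: geq_trans.
- by move=> a b /=; rewrite /geq /= -eqn_leq => /eqP.
- exact: sortcol_sorted.
rewrite perm_sort; exact: uniq_perm (SSRCT_colvals_uniq _ _ ht) us e.
Qed.

(** * The chain of rows visited by [phi] *)

Lemma max_nat_lt (P : pred nat) r : \max_(1 <= s < r | P s) s <= r.-1.
Proof.
have [[->//|[_ h _]] _] := max_natP P r; move: h; lia.
Qed.

(** A nonzero [phi_next] is smaller than the current row, so fuel [r] is enough to reach a row
    without successor. *)
Lemma phi_chain_aux_spec k t fuel r (rs := phi_chain_aux k t fuel r) : r <= fuel ->
  [/\ 0 < size rs, nth 0 rs 0 = r,
      forall j, j.+1 < size rs ->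
        0 < nth 0 rs j.+1 /\ nth 0 rs j.+1 = phi_next k t (nth 0 rs j)
    & phi_next k t (nth 0 rs (size rs).-1) = 0].
Proof.
rewrite /rs {rs}; elim: fuel r => [|n IH] r rn /=.
  by split=> //; rewrite /phi_next big_geq //; lia.
have hlt : phi_next k t r <= r.-1 by apply: max_nat_lt.
case: eqP => [h0|/eqP h0]; first by split.
have [] := IH (phi_next k t r); first by lia.
case E : (phi_chain_aux _ _ _ _) => [|a s] //= _ ha hs hl; split=> //.
by case=> [|j] /=; [rewrite ha; split=> //; rewrite lt0n | exact: hs].
Qed.

(** Without a row of length exactly [i], columns [i] and [i.+1] would have equal height. *)
Lemma phi_r1_spec i t (r1 := phi_r1 i.+1 t) : 0 < i -> colLen t i.+1 < colLen t i ->
  [/\ 0 < r1, size (row_of t r1) = i & forall r, r1 < r -> size (row_of t r) <> i].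
Proof.
move=> i0 hc.
have /hasP[row rt /eqP hrow] : has (fun row : seq nat => size row == i) t.
  apply: contraTT hc => /hasPn h; rewrite -leqNgt /colLen.
  suff e : count (fun row : seq nat => i <= size row) t =
           count (fun row : seq nat => i < size row) t by rewrite e.
  by apply: eq_in_count => row /h; rewrite (leq_eqVlt i) eq_sym => /negbTE ->.
pose r := (index row t).+1.
have hr : size (row_of t r) == i by rewrite /row_of /= nth_index // hrow.
have hrt : r < (size t).+1 by rewrite ltnS index_mem.
have [h1 h2] := max_natP (fun r => size (row_of t r) == i) (size t).+1.
have := h2 r isT hrt hr; rewrite -/(phi_r1 i.+1 t) -/r1 in h1 h2 * => hrr.
case: h1 => [h|[h3 h4 /eqP h5]]; first by move: hrr; rewrite h.
split=> // s hs /eqP e; case: (leqP s (size t)) => hst; last first.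
  by move: e i0; rewrite /row_of nth_default; [move/eqP => <- | lia].
have := h2 s _ hst e; lia.
Qed.

(** [chain_max] strengthens the maximality in [phi_next]: it ranges over all rows [r], also those
    below the current one, and excludes every candidate at the end of the chain. *)
Record phi_chain_spec (i : nat) (t : tab) (rs : seq nat) : Prop := PhiChainSpec {
  chain_size : 0 < size rs;
  chain_head : nth 0 rs 0 = phi_r1 i.+1 t;
  chain_inb : forall j, j < size rs -> inb t (nth 0 rs j) i;
  chain_step : forall j, j.+1 < size rs ->
    [/\ nth 0 rs j.+1 < nth 0 rs j,
        ent t (nth 0 rs j) i < ent t (nth 0 rs j.+1) i
      & ent t (nth 0 rs j.+1) i.+1 <= ent t (nth 0 rs j) i];
  chain_max : forall j r, j < size rs ->
    ent t (nth 0 rs j) i < ent t r i -> ent t r i.+1 <= ent t (nth 0 rs j) i ->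
    j.+1 < size rs /\ r <= nth 0 rs j.+1 }.

Arguments chain_size {i t rs}.
Arguments chain_head {i t rs}.
Arguments chain_inb {i t rs} _ {j}.
Arguments chain_step {i t rs} _ {j}.
Arguments chain_max {i t rs} _ {j r}.

Lemma phi_chainP i t : 0 < i -> is_SSRCT t -> colLen t i.+1 < colLen t i ->
  phi_chain_spec i t (phi_chain i.+1 t).
Proof.
move=> i0 ht hc; have [r10 r1i r1max] := phi_r1_spec i t i0 hc.
have [] := phi_chain_aux_spec i.+1 t (phi_r1 i.+1 t) (phi_r1 i.+1 t) (leqnn _).
rewrite -/(phi_chain i.+1 t); set rs := phi_chain _ _ => s0 h0 hstep hlast.
have r1inb : inb t (nth 0 rs 0) i by rewrite h0 inbE r10 i0 r1i leqnn.
have nxt r' := max_natP (fun r => (ent t r' i < ent t r i) && (ent t r i.+1 <= ent t r' i)) r'.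
have step j : j.+1 < size rs ->
    [/\ nth 0 rs j.+1 < nth 0 rs j,
        ent t (nth 0 rs j) i < ent t (nth 0 rs j.+1) i
      & ent t (nth 0 rs j.+1) i.+1 <= ent t (nth 0 rs j) i].
  move=> hj; have [p0 pE] := hstep j hj; have [h _] := nxt (nth 0 rs j).
  move: h; rewrite -[\max_(_ <= _ < _ | _) _]/(phi_next i.+1 t (nth 0 rs j)) -pE.
  by case=> [e|[_ ? /andP[]]]; first by rewrite e in p0.
have hin j : j < size rs -> inb t (nth 0 rs j) i.
  case: j => // j /step[_ h _]; apply: ent_gt0_inb; exact: leq_ltn_trans h.
have [_ _ _ _ trip] := ht.
have tr a b : 0 < a -> a < b -> inb t a i -> ent t b i.+1 <= ent t a i ->
    inb t b i.+1 -> inb t a i.+1 /\ ent t b i.+1 < ent t a i.+1.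
  by move=> ? ? ? ? ?; apply: trip.
(* Numbers grow downwards: the triple condition forbids candidates for the row
   [r_{j+1}] below row [r_j]. *)
have below j r : j < size rs -> nth 0 rs j < r ->
    ent t (nth 0 rs j) i < ent t r i -> ent t r i.+1 <= ent t (nth 0 rs j) i -> False.
  elim: j r => [|j IH] r hj hr h1 h2.
    (* No row below [r_1] has length [i], so row [r] reaches column [i.+1], and the triple condition
       would force a box there in row [r_1]. *)
    have hri : inb t r i by apply: ent_gt0_inb; apply: leq_ltn_trans h1.
    have hri1 : inb t r i.+1.
      move: hri; rewrite !inbE => /and3P[-> _]; rewrite leq_eqVlt => /orP[/eqP e|//].
      by case: (r1max r); rewrite -?h0.
    have [] := tr _ _ _ hr r1inb h2 hri1; first by rewrite h0.
    by rewrite h0 inbE r1i ltnn !andbF.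
  have [hs1 hs2 hs3] := step j hj.
  (* By the triple condition [r] is also a candidate for the previous chain row [nth 0 rs j]. If it
     lies above that row it contradicts the choice of [nth 0 rs j.+1]; if below, the induction
     hypothesis. *)
  have h3 : ent t r i.+1 <= ent t (nth 0 rs j) i.
    case hri1 : (inb t r i.+1); last by rewrite /ent hri1.
    have p0 : 0 < nth 0 rs j.+1 by have [] := hstep j hj.
    have [_ h] := tr _ _ p0 hr (hin _ hj) h2 hri1.
    by apply: leq_trans hs3; apply: ltnW.
  have h4 : ent t (nth 0 rs j) i < ent t r i by apply: ltn_trans h1.
  case: (ltngtP r (nth 0 rs j)) => hrj.
  - have [_ h] := nxt (nth 0 rs j).
    have := h r _ hrj; rewrite h3 h4 -[\max_(_ <= _ < _ | _) _]/(phi_next i.+1 t (nth 0 rs j)).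
    by have [_ <-] := hstep j hj => /(_ _ isT); lia.
  - by apply: (IH r) => //; lia.
  - by move: h4; rewrite hrj ltnn.
split=> // j r hj h1 h2.
have hrj : r < nth 0 rs j.
  case: (ltngtP r (nth 0 rs j)) => // hrj; first by case: (below j r).
  by move: h1; rewrite hrj ltnn.
have r0 : 0 < r by case: r h1 {h2 hrj} => //; rewrite /ent.
have [_ h] := nxt (nth 0 rs j).
move: (h r r0 hrj); rewrite h1 h2 -[\max_(_ <= _ < _ | _) _]/(phi_next i.+1 t (nth 0 rs j)).
move=> /(_ isT) hle.
have hj1 : j.+1 < size rs.
  case: (ltngtP j.+1 (size rs)) => // hjs; first by lia.
  by move: hlast hle; rewrite -hjs /= => ->; lia.
by have [_ ->] := hstep j hj1.
Qed.

Lemma chain_mono {i t rs j l} : phi_chain_spec i t rs -> j < l -> l < size rs ->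
  nth 0 rs l < nth 0 rs j /\ ent t (nth 0 rs j) i < ent t (nth 0 rs l) i.
Proof.
move=> h; elim: l => // l IH; rewrite ltnS leq_eqVlt => /orP[/eqP ->|hj] hl.
  by have [] := chain_step h hl.
have [a1 a2] := IH hj (ltnW hl); have [b1 b2 _] := chain_step h hl.
by split; [apply: ltn_trans a1 | apply: ltn_trans b2].
Qed.

Lemma chain_uniq {i t rs} : phi_chain_spec i t rs -> uniq rs.
Proof.
move=> h; apply/(uniqP 0) => a b; rewrite !inE => ha hb e.
case: (ltngtP a b) => // hab.
  by have [] := chain_mono h hab hb; rewrite e ltnn.
by have [] := chain_mono h hab ha; rewrite e ltnn.
Qed.

(** * The exiting entry and the counts in adjacent columns *)

Definition phi_exit i t :=
  let rs := phi_chain i.+1 t in ent t (nth 0 rs (size rs).-1) i.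

Lemma ent_col_next t r i y : is_SSRCT t -> 0 < i -> y < ent t r i.+1 -> y < ent t r i.
Proof. move=> ht i0 h; exact: leq_trans (SSRCT_row_le _ _ _ ht i0). Qed.

(** At the last chain row [chain_max] leaves no row that is counted in column [i] but not in column
    [i.+1]. *)
Lemma count_exit i t : 0 < i -> is_SSRCT t -> colLen t i.+1 < colLen t i ->
  count (fun b => phi_exit i t < b) (sortcol t i.+1) =
  count (fun b => phi_exit i t < b) (sortcol t i).
Proof.
move=> i0 ht hc; have h := phi_chainP i t i0 ht hc.
have s0 := chain_size h.
rewrite !count_sortcol; apply: eq_count => r.
apply/idP/idP; first exact: ent_col_next.
move=> h1; rewrite ltnNge; apply/negP => h2.
have hl : (size (phi_chain i.+1 t)).-1 < size (phi_chain i.+1 t) by lia.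
have [] := chain_max h hl h1 h2; lia.
Qed.

(** Rows decrease, so column [i.+1] never counts a row that column [i] does not; one row crossing
    [a] makes the inequality strict. *)
Lemma count_below_exit i t a : 0 < i -> is_SSRCT t -> colLen t i.+1 < colLen t i ->
  a < phi_exit i t ->
  count (fun b => a < b) (sortcol t i.+1) < count (fun b => a < b) (sortcol t i).
Proof.
move=> i0 ht hc; have h := phi_chainP i t i0 ht hc; have s0 := chain_size h.
have [r10 r1i _] := phi_r1_spec i t i0 hc.
rewrite /phi_exit /=; set rs := phi_chain _ _ in h s0 * => ha.
(* The crossing row is [r_1] if its entry exceeds [a], since it has no box in column [i.+1];
   otherwise it is the first chain row whose entry exceeds [a]. *)
have [r hr1 hr2] : exists2 r, a < ent t r i & ent t r i.+1 <= a.
  have hl : (size rs).-1 < size rs by lia.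
  elim: (size rs).-1 hl ha => [_ ha|j IH hj ha].
    exists (nth 0 rs 0) => //; rewrite (chain_head h) /ent inbE r1i ltnn !andbF //.
  case: (ltnP a (ent t (nth 0 rs j) i)) => haj; first by apply: IH => //; exact: ltnW.
  exists (nth 0 rs j.+1) => //.
  by have [_ _ hz] := chain_step h hj; apply: leq_trans haj.
rewrite !count_sortcol.
have hrt : r \in iota 1 (size t).
  have /ent_gt0_inb/and4P[? _ ? _] : 0 < ent t r i by apply: leq_ltn_trans hr1.
  by rewrite mem_iota; lia.
rewrite (permP (perm_to_rem hrt)) [X in _ < X](permP (perm_to_rem hrt)) /=.
have -> : (a < ent t r i.+1) = false by rewrite ltnNge hr2.
rewrite hr1 add0n add1n ltnS; apply: sub_count => s.
exact: ent_col_next.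
Qed.

(** * The SSRCT conditions for [phi] *)

Definition phi_fill i t (rs := phi_chain i.+1 t) r c :=
  if (c == i) && (r \in behead rs) then ent t (nth 0 rs (index r rs).-1) i
  else ent t r c.

Lemma phi_fill_neq i t r c : c != i -> phi_fill i t r c = ent t r c.
Proof. by rewrite /phi_fill => /negbTE ->. Qed.

Lemma phi_fill_chain i t j (rs := phi_chain i.+1 t) : phi_chain_spec i t rs ->
  j.+1 < size rs -> phi_fill i t (nth 0 rs j.+1) i = ent t (nth 0 rs j) i.
Proof.
move=> h hj; rewrite /phi_fill eqxx -/rs -{1}nth_behead mem_nth /=; last first.
  by rewrite size_behead ltn_predRL.
by rewrite index_uniq // (chain_uniq h).
Qed.

Lemma phi_fill_cases i t r (rs := phi_chain i.+1 t) : phi_chain_spec i t rs ->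
  (r \notin behead rs /\ phi_fill i t r i = ent t r i) \/
  exists j, [/\ j.+1 < size rs, r = nth 0 rs j.+1 & phi_fill i t r i = ent t (nth 0 rs j) i].
Proof.
move=> h; case hr : (r \in behead rs); last by left; rewrite /phi_fill -/rs hr andbF.
right; case/(nthP 0) : hr => j; rewrite size_behead ltn_predRL nth_behead => hj' <-.
by exists j; split => //; apply: phi_fill_chain.
Qed.

(** Row [r_1] has length [i], so shortening it by one removes exactly the box in column [i]. *)
Lemma phi_shapeP i t r c : 0 < i -> colLen t i.+1 < colLen t i -> 0 < r -> 0 < c ->
  (c <= nth 0 [seq (if r == phi_r1 i.+1 t then (size (row_of t r)).-1 else size (row_of t r))
              | r <- iota 1 (size t)] r.-1) =
  inb t r c && ~~ ((r == phi_r1 i.+1 t) && (c == i)).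
Proof.
move=> i0 hc r0 c0; have [r10 r1i r1max] := phi_r1_spec i t i0 hc.
rewrite (@nth_map_iota1 (fun r => if r == phi_r1 i.+1 t then (size (row_of t r)).-1
   else size (row_of t r))) //; last first.
  by move=> hr; rewrite /row_of nth_default ?if_same //; lia.
rewrite inbE r0 c0 /=; case: eqP => [->|_] /=; last by rewrite andbT.
by rewrite r1i; lia.
Qed.

Lemma phi_SSRCT i t : 0 < i -> is_SSRCT t -> colLen t i.+1 < colLen t i ->
  is_SSRCT (phi i.+1 t).
Proof.
move=> i0 ht hc; have h := phi_chainP i t i0 ht hc.
have [_ _ _ col1 trip] := ht.
have [r10 r1i r1max] := phi_r1_spec i t i0 hc.
rewrite -[phi i.+1 t]/(mk_tab _ (phi_fill i t)).
set rs := phi_chain i.+1 t in h.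
apply: SSRCT_mk_tab.
- move=> r c r0 c0; rewrite phi_shapeP // => /andP[hi _].
  case: (eqVneq c i) => [e|ne]; last by rewrite phi_fill_neq //; apply: SSRCT_pos.
  subst c; case: (phi_fill_cases _ _ r h) => [[_ ->]|[j [hj _ ->]]].
    exact: SSRCT_pos.
  by apply: SSRCT_pos => //; apply: (chain_inb h); apply: ltnW.
(* Entries of column [i] never grow, and by [chain_step] an incoming entry still dominates its
   neighbour in column [i.+1]. *)
- move=> r c r0 c0; rewrite phi_shapeP // => /andP[hi hn].
  have hle := SSRCT_row_le t r c ht c0.
  case: (eqVneq c i) => [e|ne].
    subst c; rewrite (phi_fill_neq _ _ _ i.+1); last by lia.
    case: (phi_fill_cases _ _ r h) => [[_ ->] //|[j [hj -> ->]]].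
    by have [] := chain_step h hj.
  rewrite (phi_fill_neq _ _ _ c) //.
  case: (eqVneq c.+1 i) => [e|ne']; last by rewrite phi_fill_neq.
  rewrite e; rewrite e in hle.
  case: (phi_fill_cases _ _ r h) => [[_ ->] //|[j [hj er ->]]].
  have [_ h2 _] := chain_step h hj.
  by apply: leq_trans hle; rewrite er; apply: ltnW.
- move=> r s r0 rs_lt; rewrite !phi_shapeP //; last by lia.
  move=> /andP[hr _] /andP[hs _].
  have hrs : ent t r 1 < ent t s 1 by apply: col1 => //; case/and4P: hs.
  case: (eqVneq i 1) => [e|ne]; last by rewrite !phi_fill_neq // eq_sym.
  subst i.
  (* For [i = 1] the chain has one row: entries of column 1 get smaller going up, while the chain
     requires a larger one. *)
  have sz j : j.+1 < size rs -> False.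
    move=> hj; have [h1 h2 _] := chain_step h hj.
    have /and4P[p0 _ _ _] := chain_inb h hj.
    have /and4P[_ _ p1 _] := chain_inb h (ltnW hj).
    by have := col1 _ _ p0 h1 p1; lia.
  case: (phi_fill_cases _ _ r h) => [[_ ->]|[j [/sz //]]].
  by case: (phi_fill_cases _ _ s h) => [[_ ->]|[j [/sz //]]].
move=> r s c r0 rs_lt c0; have s0 : 0 < s by lia.
rewrite !phi_shapeP // => /andP[hs hsn] /andP[hr hrn].
have tr : ent t s c.+1 <= ent t r c -> inb t r c.+1 /\ ent t s c.+1 < ent t r c.+1.
  by move=> hle; apply: trip.
case: (eqVneq c i) => [e|ne].
  (* Here the entry in [(r, i)] has not grown, so the hypothesis already holds in [t], and column
     [i.+1] is unchanged. *)
  subst c; rewrite !(phi_fill_neq _ _ _ i.+1); try by lia.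
  move=> hle; have [|h1 h2] := tr; last first.
    by split=> //; rewrite h1 /= negb_and; apply/orP; right; lia.
  case: (phi_fill_cases _ _ r h) => [[_ e]|[j [hj er e]]]; rewrite e in hle => //.
  by have [_ h2 _] := chain_step h hj; apply: leq_trans hle _; rewrite er ltnW.
rewrite (phi_fill_neq _ _ _ c) //.
case: (eqVneq c.+1 i) => [e|ne']; last first.
  by rewrite !(phi_fill_neq _ _ _ c.+1) // andbF andbT.
rewrite e in hs hsn tr *.
rewrite ?eqxx ?andbT in hsn *.
case: (phi_fill_cases _ _ s h) => [[sn ->]|[j [hj es ->]]] hle; last first.
  (* Row [s = r_{j+1}] receives the entry of row [r_j], so compare [r] with [r_j]. *)
  have [h1 h2 h3] := chain_step h hj.
  have hjt := chain_inb h (ltnW hj).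
  have [|||h4 h5] := trip r (nth 0 rs j) c r0 _ c0 _ hr; rewrite ?e //.
    by apply: (ltn_trans rs_lt); rewrite es.
  rewrite e in h4 h5; rewrite h4 /=; split.
    apply/eqP => er; move: (chain_head h); rewrite -er => er'.
    case: j hj {h1 h2 h3 hjt} es h5 hle => [|j] hj es h5 hle.
      by move: h5; rewrite er' ltnn.
    have [hm _] := chain_mono h (isT : 0 < j.+2) hj.
    by move: rs_lt; rewrite es -er' ltnNge ltnW.
  case: (phi_fill_cases _ _ r h) => [[_ ->] //|[m [hm er ->]]].
  (* Chain rows move up as the index grows, so [r < s] orders the indices, and entries grow along
     the chain. *)
  have hjm : j < m.
    case: (ltngtP j m) => // hmj.
      have hmj' : m.+1 < j.+1 by [].
      have [hm' _] := chain_mono h hmj' hj.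
      by move: rs_lt; rewrite er es ltnNge ltnW.
    by move: rs_lt; rewrite er es hmj ltnn.
  by have [] := chain_mono h hjm (ltnW hm).
have [hri hlt] := tr hle; rewrite hri /=.
(* If [r] were [r_1], row [s] below it would reach column [i.+1], and the triple condition would
   extend row [r_1] to that column. *)
have hr1 : r != phi_r1 i.+1 t.
  apply/eqP => er.
  have hs1 : inb t s i.+1.
    move: hs; rewrite !inbE => /and3P[-> _]; rewrite leq_eqVlt => /orP[/eqP es|//].
    by case: (r1max s) => //; rewrite -er.
  have [] := trip r s i r0 rs_lt i0 hs1 hri.
    by apply: leq_trans (ltnW hlt); apply: SSRCT_row_le.
  by rewrite er inbE r1i ltnn !andbF.
split=> //.
case: (phi_fill_cases _ _ r h) => [[_ ->] //|[j [hj er ->]]].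
have [h1 h2 h3] := chain_step h hj.
have hjt := chain_inb h (ltnW hj).
(* Row [s] keeps its box in column [i], so it is not [r_1]; it receives no entry, so it is no later
   chain row. *)
have sj : s != nth 0 rs j.
  case: j hj {h2 h3 hjt} er h1 => [|j] hj er h1; first by rewrite (chain_head h).
  apply: contra sn => /eqP ->; rewrite -nth_behead mem_nth //.
  by rewrite size_behead ltn_predRL ltnW.
rewrite ltnNge leq_eqVlt; apply/negP => /orP[/eqP e1|hys].
  by move: sj; rewrite (SSRCT_col_inj _ _ _ _ ht hjt hs e1) eqxx.
(* With this bound, a larger entry in row [s] would make [s] a candidate, and [chain_max] would
   place it no lower than [r]. *)
have hz : ent t s i.+1 <= ent t (nth 0 rs j) i.
  case hs1 : (inb t s i.+1); last by rewrite /ent hs1.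
  have [|_ h4] := trip r s i r0 rs_lt i0 hs1 hri.
    by apply: leq_trans (ltnW hlt); apply: SSRCT_row_le.
  by apply: leq_trans h3; rewrite -er ltnW.
have [_ hsr] := chain_max h (ltnW hj) hys hz.
by move: rs_lt; rewrite er ltnNge hsr.
Qed.

(** * Column sets of [phi] *)

(** Each chain entry moves to the next chain row, so column [i] loses only the entry of the last
    one. *)
Lemma mem_colvals_phi i t c : 0 < i -> is_SSRCT t -> colLen t i.+1 < colLen t i ->
  0 < c -> colvals (phi i.+1 t) c =i
  [pred v in colvals t c | (c != i) || (v != phi_exit i t)].
Proof.
move=> i0 ht hc c0 v; have h := phi_chainP i t i0 ht hc; have s0 := chain_size h.
rewrite -[phi i.+1 t]/(mk_tab _ (phi_fill i t)).
set rs := phi_chain i.+1 t in h s0.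
have hl : (size rs).-1 < size rs by lia.
rewrite inE; apply/idP/andP.
  case/(mem_colvals_mk_tab _ _ _ _ c0) => r [r0]; rewrite phi_shapeP // => /andP[hi hn] ->.
  case: (eqVneq c i) => [e|ne] /=; last first.
    by rewrite phi_fill_neq //; split=> //; apply/colvalsP; exists r.
  subst c; rewrite eqxx andbT in hn.
  case: (phi_fill_cases _ _ r h) => [[hr ->]|[j [hj _ ->]]].
    split; first by apply/colvalsP; exists r.
    (* By distinctness the exit value sits only in the last chain row, which either is [r_1] and
       loses its box, or receives another entry. *)
    apply/eqP => er; have erl := SSRCT_col_inj _ _ _ _ ht hi (chain_inb h hl) er.
    move: hr hn; rewrite erl -(chain_head h).
    case: (size rs).-1 (size_behead rs) => [|n] hb; first by rewrite eqxx.
    by rewrite -nth_behead mem_nth // hb.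
  split.
    by apply/colvalsP; exists (nth 0 rs j); split=> //; apply: (chain_inb h); apply: ltnW.
  have hj' : j < (size rs).-1 by rewrite ltn_predRL.
  by have [_] := chain_mono h hj' hl; rewrite ltn_neqAle => /andP[].
case=> /colvalsP[r [hi ->]] hx; apply/(mem_colvals_mk_tab _ _ _ _ c0).
have r0 : 0 < r by case/and4P: hi.
case: (eqVneq c i) hx => [e|ne] /= hx; last first.
  by exists r; rewrite phi_shapeP // hi phi_fill_neq // (negbTE ne) andbF.
subst c; case hr : (r \in rs).
  case/(nthP 0): hr => j hj er.
  have hj1 : j.+1 < size rs.
    rewrite ltn_neqAle hj andbT; apply/eqP => hjs.
    by case/eqP: hx; rewrite /phi_exit /= -/rs -er -hjs.
  have hin := chain_inb h hj1.
  have p0 : 0 < nth 0 rs j.+1 by case/and4P: hin.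
  exists (nth 0 rs j.+1); rewrite phi_shapeP // hin eqxx andbT; split=> //.
    have [hm _] := chain_mono h (isT : 0 < j.+1) hj1.
    by rewrite -(chain_head h) neq_ltn hm.
  by rewrite (phi_fill_chain _ _ _ h) // er.
exists r; rewrite phi_shapeP // hi eqxx andbT; split=> //.
  by apply: contraFN hr => /eqP ->; rewrite -(chain_head h) mem_nth.
case: (phi_fill_cases _ _ r h) => [[_ ->] //|[j [hj er _]]].
by move: hr; rewrite er mem_nth.
Qed.

Lemma sortcol_uniq t c : is_SSRCT t -> uniq (sortcol t c).
Proof. by move=> ht; rewrite sort_uniq SSRCT_colvals_uniq. Qed.

Lemma sortcol_phi i t c : 0 < i -> is_SSRCT t -> colLen t i.+1 < colLen t i -> 0 < c ->
  sortcol (phi i.+1 t) c =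
  if c == i then rem (phi_exit i t) (sortcol t c) else sortcol t c.
Proof.
move=> i0 ht hc c0.
have us := sortcol_uniq t c ht.
apply: eq_sortcol; first exact: phi_SSRCT.
- by case: ifP => // _; apply: rem_uniq.
- case: ifP => _; last exact: sortcol_sorted.
  by apply: (subseq_sorted geq_trans (rem_subseq _ _)); apply: sortcol_sorted.
move=> v; rewrite mem_colvals_phi // inE.
case: eqP => _ /=; last by rewrite andbT mem_sort.
by rewrite mem_rem_uniq // !inE mem_sort andbC.
Qed.

Lemma phi_exit_mem i t : 0 < i -> is_SSRCT t -> colLen t i.+1 < colLen t i ->
  phi_exit i t \in sortcol t i.
Proof.
move=> i0 ht hc; have h := phi_chainP i t i0 ht hc; have s0 := chain_size h.
rewrite mem_sort; apply/colvalsP; eexists; split; last by [].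
by apply: (chain_inb h); lia.
Qed.

(** * The row chosen by [tjdt] *)

Lemma count_gt_index s x : sorted geq s -> uniq s -> x \in s ->
  count (fun y => x < y) s = index x s.
Proof.
move=> ss us xs; apply: eq_leq_pos => -[|j] // _.
rewrite -gt_nth_sorted //; have ix : index x s < size s by rewrite index_mem.
case: (leqP (size s) j) => hj.
  by rewrite nth_default // ltn0 ltnNge ltnW // (leq_trans ix).
have gR : reflexive geq by move=> ? /=; apply: leqnn.
have hx : nth 0 s (index x s) = x by apply: nth_index.
have mono a b : a < b -> b < size s -> nth 0 s b < nth 0 s a.
  move=> ab bs; have as_ : a < size s by apply: ltn_trans bs.
  rewrite ltn_neqAle nth_uniq // neq_ltn ab orbT /=.
  by apply: (sorted_leq_nth geq_trans gR 0 ss) => //; rewrite ltnW.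
case: (ltngtP j (index x s)) => hji.
- by rewrite -{1}hx mono.
- by apply/negbTE; rewrite -leqNgt -{1}hx ltnW // mono.
- by rewrite hji hx ltnn.
Qed.

(** Exactly [r.-1] entries of column [i] exceed the one in row [r] of [rho t]. The [tjdt] test asks
    for at least as many in column [i.+1]: it holds at the exit by [count_exit] and fails above by
    [count_below_exit]. *)
Lemma tjdt_row_exit i t : 0 < i -> is_SSRCT t -> colLen t i.+1 < colLen t i ->
  tjdt_row i.+1 (rho t) = (index (phi_exit i t) (sortcol t i)).+1.
Proof.
move=> i0 ht hc; have [hne _ _ _ _] := ht.
set x := phi_exit i t; set A := sortcol t i; set B := sortcol t i.+1.
have xA : x \in A by apply: phi_exit_mem.
have sA : sorted geq A by apply: sortcol_sorted.
have sB : sorted geq B by apply: sortcol_sorted.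
have uA : uniq A by apply: sortcol_uniq.
have cA : count (fun y => x < y) A = index x A by apply: count_gt_index.
have cB : count (fun y => x < y) B = index x A by rewrite -cA count_exit.
have pA : index x A < size A by rewrite index_mem.
have szA : size A <= size t by rewrite -colLenE // count_size.
pose P r := inb (rho t) r i && ((r == 1) || (ent (rho t) r i < ent (rho t) r.-1 i.+1)).
(* Rows count from 1 and list positions from 0, so [r.-2] is the position of row [r.-1]. *)
have PE r : 0 < r -> P r = (r <= size A) && ((r == 1) || (nth 0 A r.-1 < nth 0 B r.-2)).
  move=> r0; rewrite /P inb_rho // colLenE // ent_rho //.
  case: r r0 => // -[|r] _ //=; by rewrite ent_rho.
have [h1 h2] := max_natP P (size (rho t)).+1; rewrite size_rho // in h1 h2.
rewrite -[tjdt_row _ _]/(\max_(1 <= r < (size (rho t)).+1 | P r) r) size_rho //.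
set m := \max_(_ <= _ < _ | _) _ in h1 h2 *.
have hp : P (index x A).+1.
  rewrite PE // pA /=; case E : (index x A) => [|p] //=.
  by rewrite -E nth_index // gt_nth_sorted // cB E.
have hm : index x A < m by apply: h2 hp => //; rewrite ltnS; apply: leq_trans szA.
case: h1 => [h|[m0 ms hPm]]; first by rewrite h in hm.
apply/eqP; rewrite eqn_leq hm andbT leqNgt; apply/negP => hlt.
move: hPm; rewrite PE //; case: m hlt {hm h2 ms m0} => // -[|m] // hlt /=.
move=> /andP[hmA]; apply/negP; rewrite -leqNgt leqNgt gt_nth_sorted // -leqNgt.
(* Any row above that of the exit holds a smaller entry, to which [count_below_exit] applies. *)
have hax : nth 0 A m.+1 < x.
  rewrite -ltnS ltnNge; apply/negP => hxa.
  move: hxa; rewrite ltnS leq_eqVlt => /orP[/eqP e|].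
    by move: hlt; rewrite e index_uniq //; lia.
  by rewrite gt_nth_sorted // cA; lia.
have := count_below_exit i t _ i0 ht hc hax.
rewrite -/A -/B (count_gt_index A) ?mem_nth // index_uniq //.
Qed.

(** This is the downward slide of a column. If [x] is absent, [index x s] is [size s], and from
    there on both sides are the default 0. *)
Lemma nth_rem s x j : nth 0 (rem x s) j =
  nth 0 s (if index x s <= j then j.+1 else j).
Proof.
elim: s j => [|a s IH] j /=; first by rewrite !nth_nil.
rewrite eq_sym; case: eqP => _ //.
by case: j => [|j] //=; rewrite IH ltnS; case: ifP.
Qed.

(** The SSRCT [tau] with [rho tau = T] stands for the preimage of [T], and the equality is stated
    after applying the bijection [rho]. The drop in [colLen] expresses the addable node. *)
Theorem theorem6p20 (i : nat) (T : tab) :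
  1 <= i -> is_SSRT T -> colLen T i.+1 < colLen T i ->
  forall tau : tab, is_SSRCT tau -> rho tau = T ->
  is_SSRCT (phi i.+1 tau) /\ rho (phi i.+1 tau) = tjdt i.+1 T.
Proof.
move=> i0 _ hT t ht eT; subst T.
have [hne _ _ _ _] := ht.
have hc : colLen t i.+1 < colLen t i by move: hT; rewrite !colLen_rho.
have hphi := phi_SSRCT i t i0 ht hc; split=> //.
have hlen c : 0 < c -> colLen (phi i.+1 t) c = colLen t c - (c == i).
  move=> c0; rewrite !colLenE // sortcol_phi //; case: eqP => [->|_]; last by rewrite subn0.
  by rewrite size_rem ?subn1 // phi_exit_mem.
have tsh r c : 0 < r -> 0 < c ->
    (c <= nth 0 [seq if r == colLen (rho t) i then (size (row_of (rho t) r)).-1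
                     else size (row_of (rho t) r) | r <- iota 1 (size (rho t))] r.-1)
    = (r <= colLen t c - (c == i)).
  move=> r0 c0.
  rewrite (@nth_map_iota1 (fun r => if r == colLen (rho t) i then
     (size (row_of (rho t) r)).-1 else size (row_of (rho t) r))) //; last first.
    by move=> hr; rewrite /row_of nth_default ?if_same //; lia.
  have hrow c' : 0 < c' -> (c' <= size (row_of (rho t) r)) = (r <= colLen t c').
    by move=> c0'; rewrite -inb_rho // inbE r0 c0'.
  rewrite colLen_rho //; case: eqP => [er|ner].
    (* The top row of column [i] stops there because column [i.+1] is shorter, so shortening it
       lowers only column [i]. *)
    have hri : size (row_of (rho t) r) = i.
      by apply/eqP; rewrite eqn_leq (hrow i) // leqNgt (hrow i.+1) // {1 2}er leqnn andbT -ltnNge.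
    rewrite hri; case: (ltngtP c i) => hci.
    - have := colLen_anti t c i (ltnW hci); lia.
    - have := colLen_anti t i.+1 c hci; lia.
    - subst c; lia.
  rewrite hrow //; case: (eqVneq c i) => [e|_]; last by rewrite subn0.
  subst c; lia.
rewrite /rho -/(rho t); apply: mk_tab_eq => r c r0 c0.
  by rewrite rho_shapeP // tsh // hlen.
rewrite rho_shapeP // hlen // => hr; rewrite sortcol_phi // tjdt_row_exit //=.
case: (eqVneq c i) => [e|ne] /=; last by rewrite ent_rho.
(* The 1-based bound of the slide in [tjdt] becomes the 0-based test of [nth_rem]. *)
subst c; rewrite nth_rem -[_ < r]/(_.+1 <= r).
case: r r0 hr => // r _ _; rewrite /= ltnS; case: ifP => _; by rewrite ent_rho.
Qed.
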